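(* In the setting of the context, suppose Property (P) holds with radius $R>0$ and functions $q_1,q_2,q_3$ (with constants $C_1,C_2,C_3$). Suppose that for all time steps $t<T-k$ the terminal cost $F_{t+k}$ of $\mathrm{MPC}_k$ is set to be the indicator function of some state $\bar y(\xi_{t+k\mid t})$ (i.e. the terminal cost used at time $t$ is $\mathbb{I}(\cdot;\bar y(\xi_{t+k\mid t}))$) satisfying $\bar y(\xi_{t+k\mid t})\in\mathcal{B}(x_{t+k}^*,R)$. Further, suppose the prediction errors $\rho_{t,\tau}$ are sufficiently small and the prediction horizon $k$ is sufficiently large, such that for all $t<T$ $$\sum_{\tau=0}^{k}\left(\left(\frac{R}{C_3}+D_{x^*}\right)q_1(\tau)+q_2(\tau)\right)\rho_{t,\tau}+2R\left(\left(\frac{R}{C_3}+D_{x^*}\right)q_1(k)+q_2(k)\right)\le\frac{R}{C_3^2L_g}.$$ Then the trajectory of $\mathrm{MPC}_k$ satisfies $x_t\in\mathcal{B}(x_t^*,R/C_3)$ for all time steps $t$, and the dynamic regret of $\mathrm{MPC}_k$ is upper bounded by $$\mathrm{cost}(\mathrm{MPC}_k)-\mathrm{cost}(\mathrm{OPT})=O\left(\sqrt{\mathrm{cost}(\mathrm{OPT})\cdot E}+E\right),$$ where $E=\sum_{\tau=0}^{k-1}\left(q_1(\tau)+q_2(\tau)\right)P(\tau)+\left(q_1(k)^2+q_2(k)^2\right)T$.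
   Context: Notation: $\|\cdot\|$ is the Euclidean norm, $\mathcal{B}(x,r)$ the closed ball of radius $r$ around $x$, and $\alpha_{t_1:t_2}=(\alpha_{t_1},\dots,\alpha_{t_2})$. The constant hidden in $O(\cdot)$ depends only on $\ell$, $L_g$, $D_{x^*}$, $R$, $C_1,C_2,C_3$ (defined below), not on $T$, $k$ or the prediction errors. Online control problem. States $x_t\in\mathbb{R}^n$, actions $u_t\in\mathbb{R}^m$, horizon $T$. Stage costs $f_t(x,u;\xi_t)$, dynamics $g_t(x,u;\xi_t)$, constraint functions $s_t(x,u;\xi_t)$ for $0\le t<T$ and terminal cost $F_T(x;\xi_T)$ are function families parameterized by $\xi_t\in\Xi_t$, where $\Xi_t$ has diameter at most $1$. The true parameters are $\xi_t^*\in\Xi_t$. The problem is to minimize $\sum_{t=0}^{T-1}f_t(x_t,u_t;\xi_t^* )+F_T(x_T;\xi_T^* )$ over $x_{0:T},u_{0:T-1}$ subject to $x_{t+1}=g_t(x_t,u_t;\xi_t^* )$, $s_t(x_t,u_t;\xi_t^* )\le 0$ for $0\le t<T$, and $x_0=x(0)$. Its optimal trajectory (with full knowledge of $\xi^*_{0:T}$) is $\mathrm{OPT}$, with states $x_t^*$ and actions $u_t^*$. For a controller, $\mathrm{cost}$ is the total cost $\sum_{t=0}^{T-1}f_t(x_t,u_t;\xi_t^* )+F_T(x_T;\xi_T^* )$ along its trajectory; $\mathrm{cost}(\mathrm{OPT})$ is the optimal value. Standing assumptions: (i) $\|x_t^*\|\le D_{x^*}$ for all $t$; (ii) $\|g_t(x,u;\xi_t^*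 )-g_t(x,u';\xi_t^* )\|\le L_g\|u-u'\|$ for all feasible $x,u,u'$; (iii) $f_t(\cdot,\cdot;\xi_t^* )$ and $F_T(\cdot;\xi_T^* )$ are nonnegative, convex and $\ell$-smooth. Predictions. With prediction horizon $k$ ($1\le k\le T$), at time $t$ the controller receives $\xi_{\tau\mid t}\in\Xi_\tau$ for $t\le\tau\le\min\{t+k,T\}$. Prediction error: $\rho_{t,\tau}=\|\xi_{t+\tau\mid t}-\xi_{t+\tau}^*\|$, with $\rho_{t,\tau}=0$ if $t+\tau>T$; power of $\tau$-step-away predictions: $P(\tau)=\sum_{t=0}^{T-\tau}\rho_{t,\tau}^2$. FTOCP. For $t_1<t_2$, initial state $z$, parameters $\xi_{t_1:t_2-1}$, terminal parameter $\zeta_{t_2}$ (also written $\xi_{t_2}$, not necessarily in $\Xi_{t_2}$) and terminal cost $F$ (possibly $+\infty$-valued), $\psi_{t_1}^{t_2}(z,\xi_{t_1:t_2-1},\zeta_{t_2};F)$ denotes an optimal solution of: minimize $\sum_{t=t_1}^{t_2-1}f_t(y_t,v_t;\xi_t)+F(y_{t_2};\zeta_{t_2})$ over $y_{t_1:t_2},v_{t_1:t_2-1}$ subject to $y_{t+1}=g_t(y_t,v_t;\xi_t)$, $s_t(y_t,v_t;\xi_t)\le0$ for $t_1\le t<t_2$, $y_{t_1}=z$. Subscripts $y_t$, $v_t$ select entries of the solution. $\mathbb{I}$ is the indicator terminal cost: $\mathbb{I}(y;\zeta)=0$ if $y=\zeta$, $+\infty$ otherwise ($\zeta\in\mathbb{R}^n$).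 $\mathrm{MPC}_k$: at each time $t$, with $t'=\min\{t+k,T\}$, it observes $x_t$ and $\xi_{t:t'\mid t}$ and applies $u_t=\psi_t^{t'}(x_t,\xi_{t:t'\mid t};F_{t'})_{v_t}$, where $F_{t'}$ for $t'<T$ is a specified terminal cost and $F_T$ is the true terminal cost family; then $x_{t+1}=g_t(x_t,u_t;\xi_t^* )$, $x_0=x(0)$. Property (P), with radius $R>0$ and nonnegative functions $q_1,q_2,q_3$ on $\{0,1,2,\dots\}$ such that $\lim_{t\to\infty}q_i(t)=0$ for $i=1,2$ and $\sum_{t=0}^\infty q_i(t)\le C_i$, $C_i\ge1$, $i=1,2,3$, means: (a) The bound $$\|\psi_{t_1}^{t_2}(z,\xi_{t_1:t_2};F)_{v_{t_1}}-\psi_{t_1}^{t_2}(z,\xi'_{t_1:t_2};F)_{v_{t_1}}\|\le\Big(\sum_{t=t_1}^{t_2}q_1(t-t_1)\delta_t\Big)\|z\|+\sum_{t=t_1}^{t_2}q_2(t-t_1)\delta_t,\quad \delta_t=\|\xi_t-\xi'_t\|,$$ holds: for $t_1=t$, $t_2=t+k$, $t<T-k$, with $F=\mathbb{I}$, $z\in\mathcal{B}(x_t^*,R)$, $\xi_{t:t+k-1}\in\Xi_t\times\cdots\times\Xi_{t+k-1}$, $\xi'_{t:t+k-1}=\xi^*_{t:t+k-1}$, and $\xi_{t+k},\xi'_{t+k}\in\mathcal{B}(x_{t+k}^*,R)\subseteq\mathbb{R}^n$; and for $t_1=t$, $t_2=T$, $t\ge T-k$, with $F=F_T$, $z\in\mathcal{B}(x_t^*,R)$,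 $\xi_{t:T}\in\Xi_t\times\cdots\times\Xi_T$, $\xi'_{t:T}=\xi^*_{t:T}$. (b) For every $t_1<T$, $t_2=T$, $F=F_T$, all $z,z'\in\mathcal{B}(x_{t_1}^*,R)$, and all $t\in[t_1,T]$, $$\|\psi_{t_1}^{T}(z,\xi^*_{t_1:T};F_T)_{y_t/v_t}-\psi_{t_1}^{T}(z',\xi^*_{t_1:T};F_T)_{y_t/v_t}\|\le q_3(t-t_1)\|z-z'\|,$$ where $y_t/v_t$ means the bound holds for both the $y_t$ entry and (for $t<T$) the $v_t$ entry. *)

(* Defs.v *)
From mathcomp Require Import all_boot all_order all_algebra.
From mathcomp Require Import all_classical all_reals all_analysis.

Set Implicit Arguments.
Unset Strict Implicit.
Unset Printing Implicit Defensive.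

Import Order.TTheory GRing.Theory Num.Theory.
Import numFieldNormedType.Exports.

Local Open Scope classical_set_scope.
Local Open Scope ring_scope.

(* The library norm on row vectors is the sup norm, hence a separate Euclidean
   norm. *)
Definition enorm (R : realType) (d : nat) (x : 'rV[R]_d) : R :=
  Num.sqrt (\sum_(i < d) x 0 i ^+ 2).

Definition eball (R : realType) (d : nat) (x : 'rV[R]_d) (r : R)
  : set 'rV[R]_d := [set y | enorm (y - x) <= r].

Definition gradient (R : realType) (d : nat) (h : 'rV[R]_d -> R)
    (w : 'rV[R]_d) : 'rV[R]_d :=
  \row_(i < d) ('d (h : 'rV[R]_d -> R^o) w (delta_mx 0 i)).

Definition smooth (R : realType) (l : R) (d : nat) (h : 'rV[R]_d -> R) : Prop :=
  (forall w, differentiable (h : 'rV[R]_d -> R^o) w) /\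
  (forall w w', enorm (gradient h w - gradient h w') <= l * enorm (w - w')).

Definition nonneg_convex_smooth (R : realType) (l : R) (d : nat)
    (h : 'rV[R]_d -> R) : Prop :=
  [/\ forall w, 0 <= h w,
      convex_function [set: convex_lmodType 'rV[R]_d] h
    & smooth l h].

(* Parameters at different times may live in Euclidean spaces of different
   dimensions [pdim t].  Time-indexed data are total functions of t : nat; only
   the times in the range 0..T (or t1..t2) are ever constrained. *)
Record ocp (R : realType) := Ocp {
  horizon : nat;
  sdim : nat;
  adim : nat;
  pdim : nat -> nat;
  cdim : nat -> nat;
  param_set : forall t, set 'rV[R]_(pdim t);
  stage_cost : forall t, 'rV[R]_sdim -> 'rV[R]_adim -> 'rV[R]_(pdim t) -> R;
  dynamics : forall t,
    'rV[R]_sdim -> 'rV[R]_adim -> 'rV[R]_(pdim t) -> 'rV[R]_sdim;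
  constraint : forall t,
    'rV[R]_sdim -> 'rV[R]_adim -> 'rV[R]_(pdim t) -> 'rV[R]_(cdim t);
  final_cost : 'rV[R]_sdim -> 'rV[R]_(pdim horizon) -> R;
  init_state : 'rV[R]_sdim;
  true_param : forall t, 'rV[R]_(pdim t);
  param_diam : forall t, (t <= horizon)%N -> forall xi xi',
    @param_set t xi -> @param_set t xi' -> enorm (xi - xi') <= 1;
  true_paramP : forall t, (t <= horizon)%N -> @param_set t (true_param t)
}.

Arguments param_set {R} P t _ : rename.
Arguments stage_cost {R} P t _ _ _ : rename.
Arguments dynamics {R} P t _ _ _ : rename.
Arguments constraint {R} P t _ _ _ : rename.
Arguments final_cost {R} P _ _ : rename.
Arguments true_param {R} P t : rename.

Definition state (R : realType) (P : ocp R) : Type := 'rV[R]_(sdim P).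
Definition action (R : realType) (P : ocp R) : Type := 'rV[R]_(adim P).
Definition params (R : realType) (P : ocp R) : Type :=
  forall t, 'rV[R]_(pdim P t).

Definition satisfies_constraint (R : realType) (P : ocp R) (t : nat)
    (x : state P) (u : action P) (xi : 'rV[R]_(pdim P t)) : Prop :=
  forall i, constraint P t x u xi 0 i <= 0.

Definition total_cost (R : realType) (P : ocp R)
    (x : nat -> state P) (u : nat -> action P) : R :=
  \sum_(0 <= t < horizon P) stage_cost P t (x t) (u t) (true_param P t)
  + final_cost P (x (horizon P)) (true_param P (horizon P)).

Definition final_coste (R : realType) (P : ocp R)
    (y : state P) (zeta : 'rV[R]_(pdim P (horizon P))) : \bar R :=
  (final_cost P y zeta)%:E.

Definition indicator_cost (R : realType) (P : ocp R) (y zeta : state P)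
  : \bar R := if y == zeta then 0%E else +oo%E.

Definition ftocp_feasible (R : realType) (P : ocp R) (t1 t2 : nat)
    (z : state P) (xi : params P)
    (y : nat -> state P) (v : nat -> action P) : Prop :=
  y t1 = z /\
  forall t, (t1 <= t < t2)%N ->
    y t.+1 = dynamics P t (y t) (v t) (xi t) /\
    satisfies_constraint (y t) (v t) (xi t).

Definition ftocp_cost (R : realType) (P : ocp R) (t1 t2 : nat)
    (xi : params P) (d : nat) (zeta : 'rV[R]_d)
    (F : state P -> 'rV[R]_d -> \bar R)
    (y : nat -> state P) (v : nat -> action P) : \bar R :=
  ((\sum_(t1 <= t < t2) stage_cost P t (y t) (v t) (xi t))%:E + F (y t2) zeta)%E.

(* (y, v) is a value of psi_{t1}^{t2}(z, xi, zeta; F).  The finiteness clause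
   excludes trajectories of cost +oo, which would all be "minimizers" of a
   problem whose terminal indicator cannot be met. *)
Definition ftocp_opt (R : realType) (P : ocp R) (t1 t2 : nat)
    (z : state P) (xi : params P) (d : nat) (zeta : 'rV[R]_d)
    (F : state P -> 'rV[R]_d -> \bar R)
    (y : nat -> state P) (v : nat -> action P) : Prop :=
  [/\ ftocp_feasible t1 t2 z xi y v,
      (ftocp_cost t1 t2 xi zeta F y v < +oo)%E
    & forall y' v', ftocp_feasible t1 t2 z xi y' v' ->
        (ftocp_cost t1 t2 xi zeta F y v <= ftocp_cost t1 t2 xi zeta F y' v')%E].

Definition ftocp_solvable (R : realType) (P : ocp R) (t1 t2 : nat)
    (z : state P) (xi : params P) (d : nat) (zeta : 'rV[R]_d)
    (F : state P -> 'rV[R]_d -> \bar R) : Prop :=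
  exists y v, ftocp_opt t1 t2 z xi zeta F y v.

Definition is_OPT (R : realType) (P : ocp R)
    (x : nat -> state P) (u : nat -> action P) : Prop :=
  ftocp_opt 0 (horizon P) (init_state P) (true_param P)
    (true_param P (horizon P)) (@final_coste R P) x u.

(* Feasibility of an action is understood with respect to some possible
   parameter in Xi_t: the action applied by MPC satisfies the constraint at the
   predicted parameter, not necessarily at the true one. *)
Definition feasible_at (R : realType) (P : ocp R) (t : nat)
    (x : state P) (u : action P) : Prop :=
  exists2 xi, param_set P t xi & satisfies_constraint x u xi.

Definition standing_assumptions (R : realType) (P : ocp R) (l Lg D : R)
    (xs : nat -> state P) : Prop :=
  [/\ forall t, (t <= horizon P)%N -> enorm (xs t) <= D,
      forall t, (t < horizon P)%N -> forall (x : state P) (u u' : action P),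
        feasible_at t x u -> feasible_at t x u' ->
        enorm (dynamics P t x u (true_param P t)
               - dynamics P t x u' (true_param P t))
          <= Lg * enorm (u - u'),
      forall t, (t < horizon P)%N ->
        nonneg_convex_smooth l (fun w : 'rV[R]_(sdim P + adim P) =>
          stage_cost P t (lsubmx w) (rsubmx w) (true_param P t))
    & nonneg_convex_smooth l (fun x : 'rV[R]_(sdim P) =>
        final_cost P x (true_param P (horizon P)))].

(* [xih t tau] is the prediction of xi_tau made at time t, indexed by the
   absolute time tau. *)
Definition predictions (R : realType) (P : ocp R) : Type := nat -> params P.

Definition valid_predictions (R : realType) (P : ocp R) (k : nat)
    (xih : predictions P) : Prop :=
  forall t tau, (t <= tau <= minn (t + k) (horizon P))%N ->
    param_set P tau (xih t tau).

Definition pred_error (R : realType) (P : ocp R) (xih : predictions P)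
    (t tau : nat) : R :=
  if (t + tau <= horizon P)%N
  then enorm (xih t (t + tau)%N - true_param P (t + tau)%N) else 0.

Definition pred_power (R : realType) (P : ocp R) (xih : predictions P)
    (tau : nat) : R :=
  \sum_(0 <= t < (horizon P - tau).+1) pred_error xih t tau ^+ 2.

(* psi_{t1}^{t2} must be defined at both arguments, and the bound holds for every
   choice of optimal solutions. *)
Definition first_action_bound (R : realType) (P : ocp R) (q1 q2 : nat -> R)
    (t1 t2 : nat) (z : state P) (xi xi' : params P)
    (d : nat) (zeta zeta' : 'rV[R]_d)
    (F : state P -> 'rV[R]_d -> \bar R) : Prop :=
  [/\ ftocp_solvable t1 t2 z xi zeta F,
      ftocp_solvable t1 t2 z xi' zeta' F
    & forall y v y' v',
        ftocp_opt t1 t2 z xi zeta F y v ->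
        ftocp_opt t1 t2 z xi' zeta' F y' v' ->
        let delta t :=
          if t == t2 then enorm (zeta - zeta') else enorm (xi t - xi' t) in
        enorm (v t1 - v' t1)
          <= (\sum_(t1 <= t < t2.+1) q1 (t - t1)%N * delta t) * enorm z
             + \sum_(t1 <= t < t2.+1) q2 (t - t1)%N * delta t].

Definition decay (R : realType) (q : nat -> R) : Prop :=
  q @ \oo --> (0 : R).

Definition nonneg_summable (R : realType) (q : nat -> R) (C : R) : Prop :=
  [/\ forall t, 0 <= q t, 1 <= C
    & (\sum_(0 <= t <oo) (q t)%:E <= C%:E)%E].

Definition parameter_perturbation (R : realType) (P : ocp R) (k : nat)
    (xs : nat -> state P) (r : R) (q1 q2 : nat -> R) : Prop :=
  (forall t, (t + k < horizon P)%N ->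
     forall (z : state P) (xi : params P) (zeta zeta' : state P),
     eball (xs t) r z ->
     (forall tau, (t <= tau < t + k)%N -> param_set P tau (xi tau)) ->
     eball (xs (t + k)%N) r zeta -> eball (xs (t + k)%N) r zeta' ->
     first_action_bound q1 q2 t (t + k) z xi (true_param P) zeta zeta'
       (@indicator_cost R P)) /\
  (forall t, (horizon P - k <= t < horizon P)%N ->
     forall (z : state P) (xi : params P),
     eball (xs t) r z ->
     (forall tau, (t <= tau <= horizon P)%N -> param_set P tau (xi tau)) ->
     first_action_bound q1 q2 t (horizon P) z xi (true_param P)
       (xi (horizon P)) (true_param P (horizon P)) (@final_coste R P)).

Definition initial_perturbation (R : realType) (P : ocp R)
    (xs : nat -> state P) (r : R) (q3 : nat -> R) : Prop :=
  let T := horizon P in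
  let xi := true_param P in
  let opt t1 z := ftocp_opt t1 T z xi (xi T) (@final_coste R P) in
  forall t1, (t1 < T)%N -> forall z z' : state P,
    eball (xs t1) r z -> eball (xs t1) r z' ->
    [/\ ftocp_solvable t1 T z xi (xi T) (@final_coste R P),
        ftocp_solvable t1 T z' xi (xi T) (@final_coste R P)
      & forall y v y' v', opt t1 z y v -> opt t1 z' y' v' ->
        (forall t, (t1 <= t <= T)%N ->
           enorm (y t - y' t) <= q3 (t - t1)%N * enorm (z - z')) /\
        (forall t, (t1 <= t < T)%N ->
           enorm (v t - v' t) <= q3 (t - t1)%N * enorm (z - z'))].

Definition property_P (R : realType) (P : ocp R) (k : nat)
    (xs : nat -> state P) (r : R) (q1 q2 q3 : nat -> R) (C1 C2 C3 : R) : Prop :=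
  [/\ 0 < r,
      [/\ nonneg_summable q1 C1, nonneg_summable q2 C2
        & nonneg_summable q3 C3],
      decay q1 /\ decay q2,
      parameter_perturbation k xs r q1 q2
    & initial_perturbation xs r q3].

(* [Fterm tau] is the MPC terminal cost F_tau, including tau = T. *)
Definition is_mpc_trajectory (R : realType) (P : ocp R) (k : nat)
    (xih : predictions P)
    (Fterm : forall tau, state P -> 'rV[R]_(pdim P tau) -> \bar R)
    (x : nat -> state P) (u : nat -> action P) : Prop :=
  [/\ forall (y : state P) zeta,
        Fterm (horizon P) y zeta = final_coste y zeta,
      x 0%N = init_state P
    & forall t, (t < horizon P)%N ->
        (exists y v,
           let t' := minn (t + k) (horizon P) in
           ftocp_opt t t' (x t) (xih t) (xih t t') (Fterm t') y v /\
           u t = v t) /\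
        x t.+1 = dynamics P t (x t) (u t) (true_param P t)].

Definition regret_error (R : realType) (P : ocp R) (k : nat)
    (xih : predictions P) (q1 q2 : nat -> R) : R :=
  \sum_(0 <= tau < k) (q1 tau + q2 tau) * pred_power xih tau
  + (q1 k ^+ 2 + q2 k ^+ 2) * (horizon P)%:R.

(* Main.v *)
Require Import Defs.
From mathcomp Require Import all_boot all_order all_algebra.
From mathcomp Require Import all_classical all_reals all_analysis.
From mathcomp Require Import ring lra zify.

Set Implicit Arguments.
Unset Strict Implicit.
Unset Printing Implicit Defensive.

Import Order.TTheory GRing.Theory Num.Theory.
Import numFieldNormedType.Exports.

Local Open Scope classical_set_scope.
Local Open Scope ring_scope.

(** Compare, at every time [t], the applied action [u t] with the first action
of the clairvoyant policy: the optimal solution of the true problem restarted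
at time [t] from the state [x t] that was actually reached.  Their distance
[e t] is the policy error, and everything is expressed through it.

1. Policy error ([policy_error]).  By the principle of optimality
([ftocp_opt_head]), the clairvoyant action also solves the [k]-step problem
whose terminal state is prescribed to be the state that the clairvoyant
trajectory visits at time [t + k].  So the two actions solve the same [k]-step
problem with different parameters, and the first part of the perturbation
property bounds [e t] by the prediction errors weighted by [q1] and [q2], plus
a term in [q1 k], [q2 k] due to the terminal states, which lie in a common ball
of radius [r].  Near the end of the horizon, when the window reaches the final
time, the second half of that part plays the same role.

2. Tracking ([restart_deviation], [tracking], [stays_near]).  The distance from
[x t] to the optimal state telescopes over the trajectories obtained by
restarting the clairvoyant policy at [0, 1, ..., t].  Two consecutive ones
differ at the restart time [s + 1] by at most [Lg * e s], and this difference is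
damped by [q3] afterwards; hence [|x t - xs t|] is at most the sum over
[s < t] of [q3 (t - s - 1) * (Lg * e s)].  The smallness hypothesis is exactly
what makes this sum at most [r / C3], so the induction that keeps the states in
the region where the perturbation bounds are available closes.

3. Summation ([sum_sqr_deviation]).  Squaring the bound on the policy error
with Jensen's inequality gives [\sum e t ^ 2 = O(E)], and the convolution with
the summable kernel [q3] is bounded in l2 by Young's inequality; so the summed
squared deviations of states and actions are [O(E)].

4. Regret ([smooth_nonneg_growth], [sum_sqrt_growth], [regret_bound]).  A
nonnegative [l]-smooth function [h] has a gradient of norm [O(sqrt (l h))], so
a deviation of length [d] costs at most [2 sqrt (l h) d + l d ^ 2].  Summing
over time with the Cauchy-Schwarz inequality yields
[O(sqrt (cost(OPT) E) + E)]. *)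

(** * Quadratic inequalities *)

(** At the vertex [- b / (2 a)] the trinomial equals [- discriminant / (4 a)].
This single fact yields both the Cauchy-Schwarz inequality and the
self-bounding property of nonnegative smooth functions. *)
Lemma quadratic_ge0_discr (R : realFieldType) (a b c : R) :
  0 <= a -> (forall s, 0 <= a * s ^+ 2 + b * s + c) -> b ^+ 2 <= 4 * a * c.
Proof.
move=> a0 H; have [a_eq0|a_neq0] := eqVneq a 0.
  have [->|b0] := eqVneq b 0; first by rewrite a_eq0; lra.
  (* At this point the affine function [b * s + c] equals [- 1]. *)
  have := H (- (c + 1) / b); rewrite a_eq0 mul0r add0r.
  by rewrite mulrC mulfVK//; lra.
have a_gt0 : 0 < a by rewrite lt_neqAle eq_sym a_neq0.
have := H (- b / (2 * a)).
have -> : a * (- b / (2 * a)) ^+ 2 + b * (- b / (2 * a)) + c =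
          (4 * a * c - b ^+ 2) / (4 * a) by field.
by rewrite pmulr_lge0 ?subr_ge0// invr_gt0 mulr_gt0.
Qed.

(** The trinomial in [t] is the weighted sum of the squares of [a i * t + b i]. *)
Lemma weighted_CauchySchwarz (R : realFieldType) (I : Type) (s : seq I)
    (w a b : I -> R) : (forall i, 0 <= w i) ->
  (\sum_(i <- s) w i * (a i * b i)) ^+ 2
  <= (\sum_(i <- s) w i * a i ^+ 2) * (\sum_(i <- s) w i * b i ^+ 2).
Proof.
move=> w0; set X := \sum_(i <- s) w i * (a i * b i).
set A := \sum_(i <- s) _; set B := \sum_(i <- s) _.
have A0 : 0 <= A by apply: sumr_ge0 => i _; rewrite mulr_ge0// sqr_ge0.
suff : (2 * X) ^+ 2 <= 4 * A * B by lra.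
apply: quadratic_ge0_discr => // t.
have -> : A * t ^+ 2 + 2 * X * t + B = \sum_(i <- s) w i * (a i * t + b i) ^+ 2.
  rewrite /A /B /X mulr_suml [2 * _]mulrC mulr_suml mulr_suml -!big_split/=.
  by apply: eq_bigr => i _; ring.
by apply: sumr_ge0 => i _; rewrite mulr_ge0// sqr_ge0.
Qed.

Lemma CauchySchwarz_sum (R : realFieldType) (I : Type) (s : seq I)
    (a b : I -> R) :
  (\sum_(i <- s) a i * b i) ^+ 2
  <= (\sum_(i <- s) a i ^+ 2) * (\sum_(i <- s) b i ^+ 2).
Proof.
have := @weighted_CauchySchwarz R I s (fun=> 1) a b (fun=> ler01).
by under eq_bigr do rewrite mul1r; under [X in _ <= X * _]eq_bigr do rewrite mul1r;
   under [X in _ <= _ * X]eq_bigr do rewrite mul1r.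
Qed.

Lemma Jensen_sqr (R : realFieldType) (I : Type) (s : seq I)
    (w b : I -> R) : (forall i, 0 <= w i) ->
  (\sum_(i <- s) w i * b i) ^+ 2
  <= (\sum_(i <- s) w i) * (\sum_(i <- s) w i * b i ^+ 2).
Proof.
move=> w0; have := @weighted_CauchySchwarz R I s w (fun=> 1) b w0.
by under eq_bigr do rewrite mul1r;
   under [X in _ <= X * _]eq_bigr do rewrite expr1n mulr1.
Qed.

(** * The Euclidean norm *)

Section Enorm.
Context {R : realType}.
Implicit Types d : nat.

Lemma enorm_ge0 d (x : 'rV[R]_d) : 0 <= enorm x.
Proof. exact: sqrtr_ge0. Qed.

Lemma sqr_enorm d (x : 'rV[R]_d) : enorm x ^+ 2 = \sum_(i < d) x 0 i ^+ 2.
Proof. by rewrite sqr_sqrtr// sumr_ge0// => i _; rewrite sqr_ge0. Qed.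

Lemma enorm0 d : enorm (0 : 'rV[R]_d) = 0.
Proof.
apply/eqP; rewrite -sqrf_eq0 sqr_enorm big1// => i _.
by rewrite mxE expr0n.
Qed.

Lemma enorm_le d (x : 'rV[R]_d) (a : R) :
  0 <= a -> \sum_(i < d) x 0 i ^+ 2 <= a ^+ 2 -> enorm x <= a.
Proof.
by move=> a0 xa; rewrite -(ler_sqr (enorm_ge0 x) a0) sqr_enorm.
Qed.

Lemma enormZ d (a : R) (x : 'rV[R]_d) : enorm (a *: x) = `|a| * enorm x.
Proof.
rewrite /enorm -sqrtr_sqr -sqrtrM ?sqr_ge0// mulr_sumr; congr Num.sqrt.
by apply: eq_bigr => i _; rewrite mxE exprMn.
Qed.

Lemma enormN d (x : 'rV[R]_d) : enorm (- x) = enorm x.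
Proof. by rewrite -scaleN1r enormZ normrN1 mul1r. Qed.

Lemma enorm_distC d (x y : 'rV[R]_d) : enorm (x - y) = enorm (y - x).
Proof. by rewrite -enormN opprB. Qed.

Lemma dot_le_enorm d (x y : 'rV[R]_d) :
  `|\sum_(i < d) x 0 i * y 0 i| <= enorm x * enorm y.
Proof.
rewrite -[leRHS]ger0_norm ?mulr_ge0 ?enorm_ge0//.
rewrite -ler_sqr ?nnegrE// !real_normK ?num_real// exprMn !sqr_enorm.
exact: CauchySchwarz_sum.
Qed.

Lemma enormD d (x y : 'rV[R]_d) : enorm (x + y) <= enorm x + enorm y.
Proof.
apply: enorm_le; first by rewrite addr_ge0 ?enorm_ge0.
have := le_trans (ler_norm _) (dot_le_enorm x y).
have -> : \sum_(i < d) (x + y) 0 i ^+ 2 =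
  \sum_(i < d) x 0 i ^+ 2 + 2 * (\sum_(i < d) x 0 i * y 0 i)
  + \sum_(i < d) y 0 i ^+ 2.
  rewrite mulr_sumr -!big_split/=; apply: eq_bigr => i _.
  by rewrite mxE; ring.
by rewrite -!sqr_enorm; lra.
Qed.

Lemma enorm_triangle d (y x z : 'rV[R]_d) :
  enorm (x - z) <= enorm (x - y) + enorm (y - z).
Proof. by apply: le_trans (enormD _ _); rewrite addrA subrK. Qed.

Lemma enorm0_eq0 d (x : 'rV[R]_d) : enorm x = 0 -> x = 0.
Proof.
move/eqP; rewrite sqrtr_eq0 => H; apply/rowP => i; rewrite mxE.
apply/eqP; rewrite -sqrf_eq0; apply/eqP.
have /psumr_eq0P -> // : \sum_(i < d) x 0 i ^+ 2 = 0.
  by apply/eqP; rewrite eq_le H sumr_ge0// => j _; rewrite sqr_ge0.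
by move=> j _; rewrite sqr_ge0.
Qed.

Lemma sqr_enorm_row_mx m n (x : 'rV[R]_m) (y : 'rV[R]_n) :
  enorm (row_mx x y) ^+ 2 = enorm x ^+ 2 + enorm y ^+ 2.
Proof.
rewrite !sqr_enorm big_split_ord/=; congr (_ + _); apply: eq_bigr => i _.
  by rewrite row_mxEl.
by rewrite row_mxEr.
Qed.

End Enorm.

(** * Growth of nonnegative smooth functions *)

Section Smooth.
Context {R : realType} (l : R) (d : nat) (h : 'rV[R]_d -> R).
Hypotheses (l_ge0 : 0 <= l) (h_smooth : smooth l h) (h_ge0 : forall w, 0 <= h w).

Lemma diff_gradient (w v : 'rV[R]_d) :
  'd (h : 'rV[R]_d -> R^o) w v = \sum_(i < d) gradient h w 0 i * v 0 i.
Proof.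
rewrite {1}[v]row_sum_delta linear_sum; apply: eq_bigr => i _.
by rewrite linearZ/= mxE mulrC.
Qed.

Lemma is_derive_line (w v : 'rV[R]_d) (s : R) :
  is_derive s 1 (fun t : R => h (t *: v + w))
    (\sum_(i < d) gradient h (s *: v + w) 0 i * v 0 i).
Proof.
have hd := h_smooth.1 (s *: v + w).
(* The difference quotients of both derivatives are the same function. *)
have E : (fun t : R =>
    t^-1 *: (((fun t : R => h (t *: v + w)) \o shift s) (t *: 1) - h (s *: v + w)))
  = (fun t : R =>
    t^-1 *: (((h : 'rV[R]_d -> R^o) \o shift (s *: v + w)) (t *: v) - h (s *: v + w))).
  by apply/funext => t /=; rewrite scalerDl [t *: 1]mulr1 addrA.
split.
  by rewrite /derivable E; exact: (@diff_derivable _ _ _ _ _ v hd).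
by rewrite /derive E -diff_gradient -deriveE.
Qed.

(** The mean value theorem on the segment from [w] to [v + w]: the gradient at
the intermediate point differs from the one at [w] by at most [l * |v|].  Integrating
along the segment gives the sharp constant [l / 2]; the lost factor 2 only
affects constants. *)
Lemma smooth_first_order (w v : 'rV[R]_d) :
  `|h (v + w) - h w - \sum_(i < d) gradient h w 0 i * v 0 i|
  <= l * enorm v ^+ 2.
Proof.
pose phi (t : R) : R := h (t *: v + w).
pose dphi t := \sum_(i < d) gradient h (t *: v + w) 0 i * v 0 i.
have dphiE (s : R) : is_derive s 1 phi (dphi s) by exact: is_derive_line.
have phi_cont : {within `[0, 1], continuous phi}.
  apply: derivable_within_continuous => s _.
  by case: (dphiE s).
have [|c] := @MVT R phi dphi 0 1 ltr01 (fun s _ => dphiE s).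
  exact: phi_cont.
rewrite in_itv/= /phi scale1r scale0r add0r subr0 mulr1 => /andP[c0 c1] ->.
rewrite /dphi.
have -> : \sum_(i < d) gradient h (c *: v + w) 0 i * v 0 i -
    \sum_(i < d) gradient h w 0 i * v 0 i =
  \sum_(i < d) (gradient h (c *: v + w) - gradient h w) 0 i * v 0 i.
  rewrite -sumrB; apply: eq_bigr => i _.
  by rewrite -mulrBl; congr (_ * _); rewrite [RHS]mxE; congr (_ + _); rewrite [RHS]mxE.
apply: le_trans (dot_le_enorm _ _) _.
rewrite expr2 mulrA ler_wpM2r ?enorm_ge0//.
apply: le_trans (h_smooth.2 _ _) _; rewrite ler_wpM2l//.
by rewrite addrK enormZ (ger0_norm (ltW c0)) ler_piMl ?enorm_ge0 ?(ltW c1).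
Qed.

(** Along the line [w + s v] the nonnegative function lies below a parabola
touching it at [s = 0]; that parabola is then nonnegative and its discriminant
is not positive. *)
Lemma self_bounding (w v : 'rV[R]_d) :
  (\sum_(i < d) gradient h w 0 i * v 0 i) ^+ 2 <= 4 * (l * h w) * enorm v ^+ 2.
Proof.
rewrite (_ : 4 * _ * _ = 4 * (l * enorm v ^+ 2) * h w); last by ring.
apply: quadratic_ge0_discr; first by rewrite mulr_ge0 ?sqr_ge0.
move=> s; have := smooth_first_order w (s *: v).
have -> : \sum_(i < d) gradient h w 0 i * (s *: v) 0 i =
  s * \sum_(i < d) gradient h w 0 i * v 0 i.
  by rewrite mulr_sumr; apply: eq_bigr => i _; rewrite [(s *: v) 0 i]mxE; ring.
rewrite enormZ exprMn real_normK ?num_real// ler_norml => /andP[_].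
by have := h_ge0 (s *: v + w); lra.
Qed.

(** Self-bounding turns the linear term of the first-order bound into
[sqrt (l * h w)]: where [h] is small, so is its slope.  This is what makes the
regret scale with the optimal cost. *)
Lemma smooth_nonneg_growth (w w' : 'rV[R]_d) :
  h w' - h w <= 2 * (Num.sqrt (l * h w) * enorm (w' - w)) + l * enorm (w' - w) ^+ 2.
Proof.
have := smooth_first_order w (w' - w); rewrite subrK ler_norml => /andP[_].
set g := \sum_(i < d) _.
have : g <= 2 * (Num.sqrt (l * h w) * enorm (w' - w)).
  apply: le_trans (ler_norm _) _.
  rewrite -ler_sqr ?nnegrE ?normr_ge0 ?mulr_ge0 ?sqrtr_ge0 ?enorm_ge0//.
  rewrite real_normK ?num_real// !exprMn sqr_sqrtr ?mulr_ge0//.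
  by have := self_bounding w (w' - w); rewrite -/g; lra.
by lra.
Qed.

End Smooth.

(** * Finite sums and causal convolutions *)

Section Sums.
Context {R : realType}.
Implicit Types (q a b : nat -> R) (m n : nat).

Lemma sum_nat_shift m n (F : nat -> R) :
  \sum_(m <= s < m + n) F s = \sum_(0 <= i < n) F (m + i)%N.
Proof.
rewrite -{1}[m]add0n big_addn addKn.
by apply: eq_bigr => i _; rewrite addnC.
Qed.

Lemma nonneg_sum_le_nat m n (F : nat -> R) : (forall i, 0 <= F i) ->
  (m <= n)%N -> \sum_(0 <= i < m) F i <= \sum_(0 <= i < n) F i.
Proof.
move=> F0 mn; rewrite (big_cat_nat _ mn)//= lerDl.
by rewrite sumr_ge0.
Qed.

Lemma sum_le_of_summable q C n :
  nonneg_summable q C -> \sum_(0 <= t < n) q t <= C.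
Proof.
move=> [q0 _ qC]; rewrite -lee_fin; apply: le_trans qC.
by rewrite -sumEFin; apply: nneseries_lim_ge => i _ _; rewrite lee_fin.
Qed.

Lemma le_of_summable q C t : nonneg_summable q C -> q t <= C.
Proof.
move=> qC; apply: le_trans (sum_le_of_summable t.+1 qC).
have [q0 _ _] := qC.
by rewrite big_nat_recr//= lerDr sumr_ge0.
Qed.

Lemma sum_reversed_kernel q t :
  \sum_(0 <= s < t) q (t - s.+1)%N = \sum_(0 <= i < t) q i.
Proof. by rewrite [RHS]big_nat_rev/= add0n. Qed.

Lemma sum_causal_conv q b n :
  \sum_(0 <= t < n.+1) \sum_(0 <= s < t) q (t - s.+1)%N * b s
  = \sum_(0 <= s < n) (\sum_(0 <= i < n - s) q i) * b s.
Proof.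
elim: n => [|n IH]; first by rewrite big_nat1 !big_geq.
rewrite big_nat_recr//= IH !big_nat_recr//= addrA; congr (_ + _); last first.
  by rewrite subSnn big_nat1 subnn.
rewrite -big_split/= big_nat_cond [RHS]big_nat_cond; apply: eq_bigr => s.
by rewrite andbT /= => sn; rewrite subSS subSn ?(ltnW sn)// big_nat_recr//= mulrDl.
Qed.

(** Young's convolution inequality, l1 kernel against l2 sequence: Jensen inside
each square costs one factor [C], and each [a s ^ 2] then collects the kernel
once more in the exchanged sum, which costs the other. *)
Lemma Young_causal_conv q C a n : nonneg_summable q C ->
  \sum_(0 <= t < n.+1) (\sum_(0 <= s < t) q (t - s.+1)%N * a s) ^+ 2
  <= C ^+ 2 * \sum_(0 <= s < n) a s ^+ 2.
Proof.
move=> qC; have [q0 C1 _] := qC; have C0 : 0 <= C by apply: le_trans C1.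
have step t : (\sum_(0 <= s < t) q (t - s.+1)%N * a s) ^+ 2 <=
   C * \sum_(0 <= s < t) q (t - s.+1)%N * a s ^+ 2.
  have := @Jensen_sqr R nat (index_iota 0 t) (fun s => q (t - s.+1)%N) a.
  move=> /(_ (fun _ => q0 _)) /le_trans; apply.
  rewrite ler_wpM2r//; first by rewrite sumr_ge0// => s _; rewrite mulr_ge0 ?sqr_ge0.
  by rewrite sum_reversed_kernel sum_le_of_summable.
apply: (@le_trans _ _ (\sum_(0 <= t < n.+1)
  C * \sum_(0 <= s < t) q (t - s.+1)%N * a s ^+ 2)).
  by apply: ler_sum => t _; exact: step.
rewrite -mulr_sumr (sum_causal_conv q (fun s => a s ^+ 2)) expr2 -mulrA.
rewrite ler_wpM2l// mulr_sumr; apply: ler_sum => s _.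
by rewrite ler_wpM2r ?sqr_ge0// sum_le_of_summable.
Qed.

(** Cauchy-Schwarz turns instantaneous growth bounds into a bound in terms of the
total reference cost and the total squared deviation. *)
Lemma sum_sqrt_growth (l : R) (c cs d : nat -> R) n :
  0 <= l -> (forall t, (t < n)%N -> 0 <= cs t) ->
  (forall t, (t < n)%N ->
     c t - cs t <= 2 * (Num.sqrt (l * cs t) * d t) + l * d t ^+ 2) ->
  \sum_(0 <= t < n) c t - \sum_(0 <= t < n) cs t <=
  2 * Num.sqrt (l * (\sum_(0 <= t < n) cs t) * (\sum_(0 <= t < n) d t ^+ 2))
  + l * \sum_(0 <= t < n) d t ^+ 2.
Proof.
move=> l0 cs0 cd.
apply: (@le_trans _ _ (2 * (\sum_(0 <= t < n) Num.sqrt (l * cs t) * d t)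
                       + l * \sum_(0 <= t < n) d t ^+ 2)).
  rewrite -sumrB !mulr_sumr -big_split/=.
  by apply: ler_sum_nat => t /andP[_]; exact: cd.
rewrite lerD2r ler_wpM2l//.
apply: le_trans (ler_norm _) _; rewrite -sqrtr_sqr ler_wsqrtr//.
apply: le_trans (CauchySchwarz_sum _ _ _) _.
rewrite ler_wpM2r ?sumr_ge0// => [i _|]; first by rewrite sqr_ge0.
rewrite mulr_sumr; apply: ler_sum_nat => t /andP[_ tn].
by rewrite sqr_sqrtr// mulr_ge0// cs0.
Qed.

End Sums.

(** * Principle of optimality *)

Section DynamicProgramming.
Context {R : realType} {P : ocp R}.
Implicit Types (y : nat -> state P) (v : nat -> action P).

Definition splice (A : Type) (m : nat) (a b : nat -> A) : nat -> A :=
  fun t => if (t < m)%N then a t else b t.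

Lemma ftocp_feasible_splice t1 tm t2 z (xi : params P) y1 v1 y2 v2 :
  (t1 <= tm <= t2)%N -> ftocp_feasible t1 tm z xi y1 v1 ->
  ftocp_feasible tm t2 (y1 tm) xi y2 v2 ->
  ftocp_feasible t1 t2 z xi (splice tm y1 y2) (splice tm v1 v2).
Proof.
move=> /andP[t1m tm2] [y1z dyn1] [y2z dyn2]; split.
  rewrite /splice; case: ltnP => // mt1.
  by have E : t1 = tm by [apply/eqP; rewrite eqn_leq t1m]; rewrite E y2z -E.
move=> t /andP[t1t tt2]; rewrite /splice; case: (ltnP t tm) => ttm.
  have [? ?] := dyn1 t (introT andP (conj t1t ttm)); split => //.
  case: ltnP => // mt.
  by have E : tm = t.+1 by [apply/eqP; rewrite eqn_leq mt]; rewrite -E y2z E.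
rewrite ltnNge leqW//=.
by apply: dyn2; rewrite ttm.
Qed.

Lemma ftocp_feasible_head t1 tm t2 z (xi : params P) y v :
  (tm <= t2)%N -> ftocp_feasible t1 t2 z xi y v ->
  ftocp_feasible t1 tm z xi y v.
Proof.
move=> tm2 [yz dyn]; split=> // t /andP[t1t ttm].
by apply: dyn; rewrite t1t (leq_trans ttm).
Qed.

Lemma ftocp_feasible_tail t1 tm t2 z (xi : params P) y v :
  (t1 <= tm)%N -> ftocp_feasible t1 t2 z xi y v ->
  ftocp_feasible tm t2 (y tm) xi y v.
Proof.
move=> t1m [yz dyn]; split=> // t /andP[tmt tt2].
by apply: dyn; rewrite tt2 (leq_trans t1m).
Qed.

Let stages t1 t2 (xi : params P) y v : R :=
  \sum_(t1 <= t < t2) stage_cost P t (y t) (v t) (xi t).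

Lemma stage_cost_splice t1 tm t2 (xi : params P) y1 v1 y2 v2 :
  (t1 <= tm <= t2)%N ->
  stages t1 t2 xi (splice tm y1 y2) (splice tm v1 v2)
  = stages t1 tm xi y1 v1 + stages tm t2 xi y2 v2.
Proof.
move=> /andP[t1m tm2]; rewrite /stages (big_cat_nat _ tm2)//=.
congr (_ + _); apply: eq_big_nat => t /andP[mt tm']; rewrite /splice.
  by rewrite tm'.
by rewrite ltnNge mt.
Qed.

Lemma splice_end tm t2 y1 y2 : (tm <= t2)%N -> splice tm y1 y2 t2 = y2 t2.
Proof. by move=> tm2; rewrite /splice ltnNge tm2. Qed.

(** A better tail could be glued to the optimal head. *)
Lemma ftocp_opt_tail t1 tm t2 z (xi : params P) d (zeta : 'rV[R]_d)
    (F : state P -> 'rV[R]_d -> \bar R) y v :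
  (t1 <= tm <= t2)%N -> ftocp_opt t1 t2 z xi zeta F y v ->
  ftocp_opt tm t2 (y tm) xi zeta F y v.
Proof.
move=> t12 [feas fin opt]; have /andP[t1m tm2] := t12.
have costE y' v' : (ftocp_cost t1 t2 xi zeta F (splice tm y y') (splice tm v v') =
    (stages t1 tm xi y v)%:E + ftocp_cost tm t2 xi zeta F y' v')%E.
  rewrite /ftocp_cost splice_end// -/(stages t1 t2 xi _ _) stage_cost_splice//.
  by rewrite EFinD addeA.
have selfE (A : Type) (a : nat -> A) : splice tm a a = a.
  by apply/funext => t; rewrite /splice if_same.
split; first exact: ftocp_feasible_tail feas.
  have := costE y v; rewrite !selfE => cE; move: fin; rewrite cE.
  by rewrite !ltey; apply: contraNN => /eqP ->; rewrite addey.
move=> y' v' feas'.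
have := opt _ _ (ftocp_feasible_splice t12 (ftocp_feasible_head tm2 feas) feas').
by rewrite costE; have := costE y v; rewrite !selfE => ->; rewrite leeD2lE.
Qed.

(** A better head with the same end point could be glued to the optimal tail; all
other heads have infinite indicator cost.  Finiteness of the terminal cost is
needed to cancel it. *)
Lemma ftocp_opt_head t1 tm t2 z (xi : params P) d (zeta : 'rV[R]_d)
    (F : state P -> 'rV[R]_d -> \bar R) y v :
  (t1 <= tm <= t2)%N -> F (y t2) zeta \is a fin_num ->
  ftocp_opt t1 t2 z xi zeta F y v ->
  ftocp_opt t1 tm z xi (y tm) (@indicator_cost R P) y v.
Proof.
move=> t12 Ffin [feas fin opt]; have /andP[t1m tm2] := t12.
split; first exact: ftocp_feasible_head feas.
  by rewrite /ftocp_cost /indicator_cost eqxx adde0 ltry.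
move=> y' v' feas'; rewrite /ftocp_cost /indicator_cost eqxx adde0.
case: eqP => [E|_]; [rewrite adde0|by rewrite addey// leey].
have feas_tail := ftocp_feasible_tail t1m feas; rewrite -E in feas_tail.
have := opt _ _ (ftocp_feasible_splice t12 feas' feas_tail).
rewrite /ftocp_cost splice_end// leeD2rE// !lee_fin.
rewrite -!/(stages _ _ _ _ _) stage_cost_splice//.
by rewrite /stages (big_cat_nat t1m tm2)//= lerD2r.
Qed.

End DynamicProgramming.

(** * Prediction errors *)

Section Predictions.
Context {R : realType} {P : ocp R}.

Definition true_opt (t : nat) (z : state P)
    (y : nat -> state P) (v : nat -> action P) : Prop :=
  ftocp_opt t (horizon P) z (true_param P) (true_param P (horizon P))
    (@final_coste R P) y v.

Lemma true_opt_tail t1 t z y v : (t1 <= t <= horizon P)%N ->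
  true_opt t1 z y v -> true_opt t (y t) y v.
Proof. exact: ftocp_opt_tail. Qed.

Variables (k : nat) (xih : predictions P).
Hypothesis valid : valid_predictions k xih.

Lemma pred_error_ge0 t tau : 0 <= pred_error xih t tau.
Proof. by rewrite /pred_error; case: ifP => // _; exact: enorm_ge0. Qed.

Lemma pred_error_le1 t tau : (tau <= k)%N -> pred_error xih t tau <= 1.
Proof.
move=> tauk; rewrite /pred_error; case: ifP => // tT.
apply: (param_diam tT); last exact: true_paramP.
by apply: valid; rewrite leq_addr leq_min tT andbT leq_add2l.
Qed.

(** The errors beyond the horizon vanish, so the two ranges of summation, neither
of which contains the other in general, give comparable sums. *)
Lemma sum_pred_error_sqr tau :
  \sum_(0 <= t < horizon P) pred_error xih t tau ^+ 2 <= pred_power xih tau.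
Proof.
rewrite /pred_power.
have [le|lt] := leqP (horizon P) (horizon P - tau).+1.
  by apply: nonneg_sum_le_nat => // i; rewrite sqr_ge0.
rewrite (big_cat_nat _ (ltnW lt))//= [X in _ + X]big_nat_cond [X in _ + X]big1 ?addr0//.
move=> t /andP[/andP[ge _] _]; rewrite /pred_error ifF ?expr0n//.
by apply/negbTE; lia.
Qed.

Lemma sum_power_error (q1 q2 : nat -> R) :
  (forall t, 0 <= q1 t) -> (forall t, 0 <= q2 t) ->
  \sum_(0 <= t < horizon P) (\sum_(0 <= tau < k)
      (q1 tau + q2 tau) * pred_error xih t tau ^+ 2 + (q1 k ^+ 2 + q2 k ^+ 2))
  <= regret_error k xih q1 q2.
Proof.
move=> q10 q20; rewrite big_split/= exchange_big/= /regret_error.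
rewrite sumr_const_nat subn0 mulr_natr lerD2r; apply: ler_sum => tau _.
by rewrite -mulr_sumr ler_wpM2l ?addr_ge0// sum_pred_error_sqr.
Qed.

End Predictions.

Lemma affine_bound (R : realType) (e A A' B B' z M : R) :
  0 <= z -> 0 <= A -> A <= A' -> B <= B' -> z <= M ->
  e <= A * z + B -> e <= A' * M + B'.
Proof.
move=> z0 A0 AA BB zM /le_trans; apply; rewrite lerD// ler_pM//.
Qed.

(** The factor relating the squared policy errors to [E].  States within [r / C3]
of the optimal ones have norm at most [r / C3 + D], the weight of [q1]; adding
[1] makes it dominate the weight of [q2] too.  [C1 + C2] is the mass of the
kernel in Jensen's inequality, the last summand comes from the terminal terms. *)
Definition policy_gain (R : realType) (D r C1 C2 C3 : R) : R :=
  2 * (r / C3 + D + 1) ^+ 2 * (C1 + C2 + 2 * (1 + 2 * r) ^+ 2).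

(** The factor relating to [E] the squared deviations of states and actions from
the optimal trajectory: [(C3 * Lg) ^ 2] is Young's inequality for the states,
and [2 * C3 ^ 2] and [2] split the action deviation. *)
Definition deviation_gain (R : realType) (Lg D r C1 C2 C3 : R) : R :=
  ((1 + 2 * C3 ^+ 2) * (C3 * Lg) ^+ 2 + 2) * policy_gain D r C1 C2 C3.

(** * The closed loop *)

Section MPC.
Context {R : realType}.
Variables (l Lg D r C1 C2 C3 : R) (Lg_gt0 : 0 < Lg).
Variables (P : ocp R) (xs : nat -> state P) (us : nat -> action P)
    (k : nat) (xih : predictions P) (q1 q2 q3 : nat -> R)
    (Fterm : forall tau, state P -> 'rV[R]_(pdim P tau) -> \bar R)
    (ybar : forall tau, 'rV[R]_(pdim P tau) -> state P)
    (x : nat -> state P) (u : nat -> action P).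
Hypotheses (OPT : is_OPT xs us)
  (standing : standing_assumptions l Lg D xs)
  (k_range : (1 <= k <= horizon P)%N)
  (valid : valid_predictions k xih)
  (PP : property_P k xs r q1 q2 q3 C1 C2 C3)
  (term_indicator : forall t, (t + k < horizon P)%N ->
     (forall y : state P,
        @Fterm (t + k)%N y (xih t (t + k)%N)
        = indicator_cost y (@ybar (t + k)%N (xih t (t + k)%N))) /\
     eball (xs (t + k)%N) r (@ybar (t + k)%N (xih t (t + k)%N)))
  (small : forall t, (t < horizon P)%N ->
     \sum_(0 <= tau < k.+1)
        ((r / C3 + D) * q1 tau + q2 tau) * pred_error xih t tau
     + 2%:R * r * ((r / C3 + D) * q1 k + q2 k)
     <= r / (C3 ^+ 2 * Lg))
  (traj : is_mpc_trajectory k xih Fterm x u).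

Local Notation T := (horizon P).
Local Notation near_opt := (fun t => enorm (x t - xs t) <= r / C3).

Let r_gt0 : 0 < r. Proof. by case: PP. Qed.
Let q1S : nonneg_summable q1 C1. Proof. by case: PP => _ []. Qed.
Let q2S : nonneg_summable q2 C2. Proof. by case: PP => _ []. Qed.
Let q3S : nonneg_summable q3 C3. Proof. by case: PP => _ []. Qed.
Let q1_ge0 t : 0 <= q1 t. Proof. by case: q1S. Qed.
Let q2_ge0 t : 0 <= q2 t. Proof. by case: q2S. Qed.
Let q3_ge0 t : 0 <= q3 t. Proof. by case: q3S. Qed.
Let C3_ge1 : 1 <= C3. Proof. by case: q3S. Qed.
Let C3_gt0 : 0 < C3. Proof. exact: lt_le_trans C3_ge1. Qed.
Let rC_ge0 : 0 <= r / C3. Proof. by rewrite divr_ge0 ?ltW. Qed.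
Let rC_le : r / C3 <= r. Proof. by rewrite ler_pdivrMr// ler_peMr// ltW. Qed.
Let k_gt0 : (0 < k)%N. Proof. by case/andP: k_range. Qed.
Let T_gt0 : (0 < T)%N. Proof. by case/andP: k_range => /leq_trans; apply. Qed.
Let xs_le t : (t <= T)%N -> enorm (xs t) <= D.
Proof. by case: standing => + _ _ _; apply. Qed.
Let D_ge0 : 0 <= D. Proof. exact: le_trans (enorm_ge0 (xs 0%N)) (xs_le _). Qed.

Let true_optP t : (t <= T)%N -> true_opt t (xs t) xs us.
Proof. by move=> tT; apply: true_opt_tail OPT. Qed.

Let xs_ball t : eball (xs t) r (xs t).
Proof. by rewrite /eball/= subrr enorm0 ltW. Qed.

Let near_ball t : near_opt t -> eball (xs t) r (x t).
Proof. by move=> /le_trans; apply. Qed.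

Lemma perturb_state t1 z z' y v y' v' t : (t1 < T)%N -> (t1 <= t <= T)%N ->
  eball (xs t1) r z -> eball (xs t1) r z' ->
  true_opt t1 z y v -> true_opt t1 z' y' v' ->
  enorm (y t - y' t) <= q3 (t - t1)%N * enorm (z - z').
Proof.
move=> t1T tT zr z'r o o'; have [_ _ _ _ /(_ t1 t1T z z' zr z'r)] := PP.
by move=> [_ _ /(_ y v y' v' o o')[+ _]]; apply.
Qed.

Lemma perturb_action t z z' y v y' v' : (t < T)%N ->
  eball (xs t) r z -> eball (xs t) r z' ->
  true_opt t z y v -> true_opt t z' y' v' ->
  enorm (v t - v' t) <= q3 0%N * enorm (z - z').
Proof.
move=> tT zr z'r o o'; have [_ _ _ _ /(_ t tT z z' zr z'r)] := PP.
move=> [_ _ /(_ y v y' v' o o')[_ /(_ t)]]; rewrite subnn; apply.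
by rewrite leqnn.
Qed.

(** At the initial time itself the perturbation bound reads
[|z - z'| <= q3 0 * |z - z'|]; hence [q3 0 >= 1] unless the state space is
trivial.  It makes the error of the last step fit the pattern
[q3 (t - s - 1) * (Lg * e s)] at [s = t - 1]. *)
Lemma enorm_le_q3 (w : state P) : enorm w <= q3 0%N * enorm w.
Proof.
have [->|w0] := eqVneq w 0; first by rewrite enorm0 mulr0.
have w_gt0 : 0 < enorm w.
  rewrite lt_neqAle enorm_ge0 andbT eq_sym; apply: contraNneq w0 => w0.
  by apply/eqP; exact: enorm0_eq0.
(* Scaling [w] to length [r] keeps [xs 0 + c *: w] in the ball. *)
pose c := r / enorm w; have c_gt0 : 0 < c by rewrite divr_gt0.
have zr : eball (xs 0%N) r (xs 0%N + c *: w).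
  by rewrite /eball/= addrC addKr enormZ gtr0_norm// divfK// gt_eqF.
have [_ _ _ _ /(_ 0%N T_gt0 _ _ zr (xs_ball 0%N))] := PP.
move=> [[y [v o]] [y' [v' o']] _].
have := perturb_state T_gt0 (leq0n T) zr (xs_ball 0%N) o o'.
have [[-> _] _ _] := o; have [[-> _] _ _] := o'.
rewrite addrC addKr enormZ gtr0_norm// subnn mulrCA ler_pM2l//.
Qed.

Let coef tau := (r / C3 + D) * q1 tau + q2 tau.

(** Both actions are first actions of FTOCPs with the same initial state.  If the
window ends before [T], the clairvoyant one is a [k]-step optimum with its own
state at [t + k] as target, which is within [r] of the optimal one because
[q3 <= C3]; so is the target of the controller, and the two targets are at most
[2 r] apart.  The bound covers the window that reaches [T] as well, where the
last parameter is merely mispredicted. *)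
Lemma policy_error t y v : (t < T)%N -> near_opt t -> true_opt t (x t) y v ->
  enorm (u t - v t) <= \sum_(0 <= tau < k.+1) coef tau * pred_error xih t tau
                       + 2 * r * coef k.
Proof.
move=> tT nt o; have [_ _ /(_ t tT) [[y' [v' [opt' ->]]] _]] := traj.
have xr := near_ball nt.
have xM : enorm (x t) <= r / C3 + D.
  rewrite -[x t](subrK (xs t)); apply: le_trans (enormD _ _) _.
  by rewrite lerD// xs_le// ltnW.
pose W (q : nat -> R) :=
  \sum_(0 <= tau < k.+1) q tau * pred_error xih t tau + 2 * r * q k.
(* Common form of both cases: parameter errors [delta] on a window ending at
   [t2], whose weighted sums are controlled for any nonnegative weights. *)
suff [t2 [delta [del0 bound wbound]]] : exists t2 delta,
    [/\ (forall s, 0 <= delta s),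
        enorm (v' t - v t)
          <= (\sum_(t <= s < t2.+1) q1 (s - t)%N * delta s) * enorm (x t)
          + \sum_(t <= s < t2.+1) q2 (s - t)%N * delta s
      & forall q, (forall i, 0 <= q i) ->
          \sum_(t <= s < t2.+1) q (s - t)%N * delta s <= W q].
  have := affine_bound (enorm_ge0 _) _ (wbound q1 q1_ge0) (wbound q2 q2_ge0) xM bound.
  have -> : W q1 * (r / C3 + D) + W q2 =
    \sum_(0 <= tau < k.+1) coef tau * pred_error xih t tau + 2 * r * coef k.
    rewrite /W [in RHS](eq_bigr (fun tau =>
      (r / C3 + D) * (q1 tau * pred_error xih t tau)
      + q2 tau * pred_error xih t tau)); last by move=> i _; rewrite /coef; ring.
    by rewrite big_split/= -mulr_sumr /coef; ring.
  by apply; rewrite sumr_ge0// => i _; rewrite mulr_ge0.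
have [tkT|Ttk] := ltnP (t + k) T.
  have Emin : minn (t + k) T = (t + k)%N by apply/minn_idPl; exact: ltnW.
  rewrite Emin in opt'; have [Find ybar_ball] := term_indicator tkT.
  have oI : ftocp_opt t (t + k) (x t) (xih t) (@ybar (t + k)%N (xih t (t + k)%N))
      (@indicator_cost R P) y' v'.
    have [feas fin opt] := opt'; split => //; first by rewrite /ftocp_cost -Find.
    by move=> a b /opt; rewrite /ftocp_cost !Find.
  have ho : ftocp_opt t (t + k) (x t) (true_param P) (y (t + k)%N)
      (@indicator_cost R P) y v.
    by apply: ftocp_opt_head o; rewrite // leq_addr ltnW.
  have y_ball : eball (xs (t + k)%N) r (y (t + k)%N).
    have tk : (t <= t + k <= T)%N by rewrite leq_addr ltnW.
    apply: le_trans (perturb_state tT tk xr (xs_ball t) o (true_optP (ltnW tT))) _.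
    rewrite -[leRHS](mulfVK (lt0r_neq0 C3_gt0)) mulrC ler_pM ?enorm_ge0//.
    exact: le_of_summable.
  have [_ _ _ [+ _] _] := PP.
  move=> /(_ t tkT (x t) (xih t) _ _ xr _ ybar_ball y_ball)[].
    move=> s /andP[ts sk]; apply: valid; rewrite ts leq_min (ltnW sk).
    by rewrite ltnW// (ltn_trans sk).
  move=> _ _ /(_ _ _ _ _ oI ho) /= bound.
  pose delta s := if s == (t + k)%N
    then enorm (@ybar (t + k)%N (xih t (t + k)%N) - y (t + k)%N)
    else enorm (xih t s - true_param P s).
  exists (t + k)%N, delta; split => //.
    by move=> s; rewrite /delta; case: ifP => _; exact: enorm_ge0.
  move=> q q0; rewrite -addnS sum_nat_shift big_nat_recr//= /W big_nat_recr//=.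
  rewrite -addrA lerD//.
    apply: ler_sum_nat => i /andP[_ ik]; rewrite addKn ler_wpM2l// /delta.
    rewrite eqn_add2l ltn_eqF// /pred_error ifT//.
    by rewrite (leq_trans _ (ltnW tkT))// leq_add2l ltnW.
  rewrite /delta eqxx addKn.
  have : 0 <= q k * pred_error xih t k by rewrite mulr_ge0// pred_error_ge0.
  have : q k * enorm (@ybar (t + k)%N (xih t (t + k)%N) - y (t + k)%N) <= q k * (r + r).
    rewrite ler_wpM2l//; apply: le_trans (enorm_triangle (xs (t + k)%N) _ _) _.
    by rewrite lerD// enorm_distC.
  lra.
have Emin : minn (t + k) T = T by apply/minn_idPr.
rewrite Emin in opt'; have [Ffin _ _] := traj.
have oI : ftocp_opt t T (x t) (xih t) (xih t T) (@final_coste R P) y' v'.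
  have [feas fin opt] := opt'; split => //; first by rewrite /ftocp_cost -Ffin.
  by move=> a b /opt; rewrite /ftocp_cost !Ffin.
have [_ _ _ [_ +] _] := PP.
have tr : (T - k <= t < T)%N by rewrite tT leq_subLR addnC Ttk.
move=> /(_ t tr (x t) (xih t) xr)[].
  move=> s /andP[ts sT]; apply: valid; rewrite ts leq_min sT andbT.
  exact: leq_trans Ttk.
move=> _ _ /(_ _ _ _ _ oI o) /= bound.
pose delta s := if s == T then enorm (xih t T - true_param P T)
  else enorm (xih t s - true_param P s).
exists T, delta; split => //.
  by move=> s; rewrite /delta; case: ifP => _; exact: enorm_ge0.
have deltaE i : (t + i <= T)%N -> delta (t + i)%N = pred_error xih t i.
  move=> tiT; rewrite /delta /pred_error tiT.
  by case: eqP => [<-|].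
move=> q q0.
have -> : T.+1 = (t + (T.+1 - t))%N by rewrite subnKC// ltnW// ltnS ltnW.
rewrite sum_nat_shift.
apply: (@le_trans _ _ (\sum_(0 <= i < T.+1 - t) q i * pred_error xih t i)).
  apply: ler_sum_nat => i /andP[_ iT]; rewrite addKn deltaE//.
  by move: iT; rewrite ltn_subRL ltnS.
rewrite /W.
apply: (@le_trans _ _ (\sum_(0 <= tau < k.+1) q tau * pred_error xih t tau)).
  apply: nonneg_sum_le_nat => [i|]; first by rewrite mulr_ge0// pred_error_ge0.
  by rewrite leq_subLR addnS ltnS.
by rewrite lerDl !mulr_ge0// ltW.
Qed.

Lemma policy_error_small t y v : (t < T)%N -> near_opt t -> true_opt t (x t) y v ->
  enorm (u t - v t) <= r / (C3 ^+ 2 * Lg).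
Proof. by move=> tT nt o; apply: le_trans (policy_error tT nt o) (small tT). Qed.

(** Both actions are feasible in the sense of the Lipschitz assumption: the applied
one at the predicted parameter, the clairvoyant one at the true parameter. *)
Lemma one_step_error t y v : (t < T)%N -> true_opt t (x t) y v ->
  enorm (x t.+1 - y t.+1) <= Lg * enorm (u t - v t).
Proof.
move=> tT [[yt dyn] _ _].
have [_ _ /(_ t tT) [[y' [v' [opt' uv]]] ->]] := traj.
have [-> yfeas] := dyn t (introT andP (conj (leqnn t) tT)).
move: yfeas; rewrite yt => yfeas.
have [_ + _ _] := standing; apply => //; last first.
  by exists (true_param P t) => //; exact: true_paramP (ltnW tT).
exists (xih t t).
  by apply: valid; rewrite leqnn leq_min leq_addr ltnW.
have [[y't dyn'] _ _] := opt'.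
have tk : (t <= t < minn (t + k) T)%N.
  by rewrite leqnn leq_min tT andbT -[X in (X < _)%N]addn0 ltn_add2l k_gt0.
by have [_] := dyn' t tk; rewrite y't uv.
Qed.

(** Totalized outside the region where an optimum is known to exist, so that the
choice can be made before the states are shown to stay in that region. *)
Lemma exists_restarts : exists YV : nat -> (nat -> state P) * (nat -> action P),
  forall s, (s < T)%N -> near_opt s -> true_opt s (x s) (YV s).1 (YV s).2.
Proof.
suff /choice [YV YV_opt] : forall s, exists yv : (nat -> state P) * (nat -> action P),
    (s < T)%N -> near_opt s -> true_opt s (x s) yv.1 yv.2.
  by exists YV.
move=> s.
have [[sT ns]|no] := pselect ((s < T)%N /\ near_opt s).
  have [_ _ _ _ /(_ s sT _ _ (near_ball ns) (near_ball ns))] := PP.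
  by move=> [[y [v o]] _ _]; exists (y, v).
by exists (fun=> 0, fun=> 0) => sT ns; exfalso; apply: no.
Qed.

(* [Y s], [V s]: the clairvoyant trajectory restarted at time [s] from [x s]. *)
Variables (Y : nat -> nat -> state P) (V : nat -> nat -> action P).
Hypothesis YV_opt : forall s, (s < T)%N -> near_opt s -> true_opt s (x s) (Y s) (V s).
Let e s := enorm (u s - V s s).

(** Induction on the restart time [j].  The trajectory restarted at [j + 1] is
compared with the one restarted at [j]: the tail of the latter is optimal from
its own state at [j + 1], so [q3] damps the one-step error [Lg * e j] made in
between. *)
Lemma restart_deviation j t y v : (j < T)%N -> (forall s, (s <= j)%N -> near_opt s) ->
  true_opt j (x j) y v -> (j <= t <= T)%N ->
  enorm (y t - xs t) <= \sum_(0 <= s < j) q3 (t - s.+1)%N * (Lg * e s).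
Proof.
elim: j y v => [|j IH] y v jT near o /andP[jt tT].
  have x0 : x 0%N = xs 0%N by have [_ -> _] := traj; have [[-> _] _ _] := OPT.
  rewrite x0 in o.
  have := perturb_state jT (introT andP (conj jt tT)) (xs_ball 0%N) (xs_ball 0%N)
            o (true_optP (leq0n T)).
  by rewrite subrr enorm0 mulr0 big_geq.
have jT' : (j < T)%N := ltnW jT.
have nearj := near j (leqnSn j).
have oj := YV_opt jT' nearj.
rewrite big_nat_recr//= addrC.
apply: le_trans (enorm_triangle (Y j t) _ _) _.
rewrite lerD//; last first.
  apply: (IH _ (V j)) => //; last by rewrite tT (ltnW jt).
  by move=> s /leqW; exact: near.
have Y_ball : eball (xs j.+1) r (Y j j.+1).
  have jj : (j <= j.+1 <= T)%N by rewrite leqnSn.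
  apply: le_trans (perturb_state jT' jj (near_ball nearj) (xs_ball j) oj
                     (true_optP (ltnW jT'))) _.
  rewrite -[leRHS](mulfVK (lt0r_neq0 C3_gt0)) mulrC ler_pM ?enorm_ge0//.
  exact: le_of_summable.
have oj' : true_opt j.+1 (Y j j.+1) (Y j) (V j).
  by apply: true_opt_tail oj; rewrite leqnSn.
apply: le_trans (perturb_state jT (introT andP (conj jt tT))
   (near_ball (near _ (leqnn _))) Y_ball o oj') _.
by rewrite ler_wpM2l// one_step_error.
Qed.

(** At time [t = j + 1] the trajectory restarted at [j] replaces the one restarted
at [t], so the last summand is the one-step error itself; this also covers
[t = T], where no problem is left to restart. *)
Lemma tracking t : (t <= T)%N -> (forall s, (s < t)%N -> near_opt s) ->
  enorm (x t - xs t) <= \sum_(0 <= s < t) q3 (t - s.+1)%N * (Lg * e s).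
Proof.
case: t => [|j] jT near.
  have -> : x 0%N = xs 0%N by have [_ -> _] := traj; have [[-> _] _ _] := OPT.
  by rewrite subrr enorm0 big_geq.
have oj := YV_opt jT (near j (leqnn _)).
rewrite big_nat_recr//= subnn addrC.
apply: le_trans (enorm_triangle (Y j j.+1) _ _) _.
rewrite lerD//; last by apply: restart_deviation oj _ => //; rewrite leqnSn.
apply: le_trans (enorm_le_q3 _) _.
by rewrite ler_wpM2l// one_step_error.
Qed.

(** The uniform bound [r / (C3 ^ 2 * Lg)] on the policy errors, summed against
[q3], gives back [r / C3]. *)
Lemma stays_near t : (t <= T)%N -> near_opt t.
Proof.
have [n] := ubnP t; elim: n t => // n IH t tn tT.
have near s : (s < t)%N -> near_opt s.
  by move=> st; apply: IH; [exact: leq_trans st tn|exact: leq_trans (ltnW st) tT].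
apply: le_trans (tracking tT near) _.
apply: (@le_trans _ _ (\sum_(0 <= s < t) q3 (t - s.+1)%N * (r / C3 ^+ 2))).
  apply: ler_sum_nat => s /andP[_ st]; rewrite ler_wpM2l//.
  have sT : (s < T)%N := leq_trans st tT.
  rewrite (_ : r / C3 ^+ 2 = Lg * (r / (C3 ^+ 2 * Lg))).
    rewrite ler_wpM2l ?(ltW Lg_gt0)//.
    exact: policy_error_small (near s st) (YV_opt sT (near s st)).
  by field; rewrite !gt_eqF.
rewrite -mulr_suml sum_reversed_kernel.
apply: (@le_trans _ _ (C3 * (r / C3 ^+ 2))).
  by rewrite ler_wpM2r ?sum_le_of_summable// divr_ge0 ?sqr_ge0 ?ltW.
by rewrite (_ : C3 * _ = r / C3)//; field; rewrite gt_eqF.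
Qed.

Let opt_s s : (s < T)%N -> true_opt s (x s) (Y s) (V s).
Proof. by move=> sT; apply: YV_opt => //; exact/stays_near/ltnW. Qed.

Let M := r / C3 + D + 1.
Local Notation policy_const := (policy_gain D r C1 C2 C3).

Lemma policy_gain_ge0 : 0 <= policy_const.
Proof.
have [_ C1_ge1 _] := q1S; have [_ C2_ge1 _] := q2S.
have ? : 0 <= C1 := le_trans ler01 C1_ge1.
have ? : 0 <= C2 := le_trans ler01 C2_ge1.
by rewrite /policy_gain !(sqr_ge0, mulr_ge0, addr_ge0).
Qed.

(** Jensen with the weights [q1 + q2], of total mass at most [C1 + C2], handles the
errors before the end of the window.  The error at distance [k] is only known
to be at most the diameter [1] of the parameter set; it joins the terminal
terms, whence [1 + 2 r]. *)
Lemma sqr_policy_error t : (t < T)%N ->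
  e t ^+ 2 <= policy_const *
    (\sum_(0 <= tau < k) (q1 tau + q2 tau) * pred_error xih t tau ^+ 2
     + (q1 k ^+ 2 + q2 k ^+ 2)).
Proof.
move=> tT; have := policy_error tT (stays_near (ltnW tT)) (opt_s tT).
set q := fun tau => q1 tau + q2 tau.
have q_ge0 i : 0 <= q i by rewrite addr_ge0.
rewrite -/(e t) big_nat_recr//=.
set A := \sum_(0 <= tau < k) q tau * pred_error xih t tau.
set B := \sum_(0 <= tau < k) q tau * pred_error xih t tau ^+ 2.
have M_ge0 : 0 <= M by rewrite !addr_ge0.
have coef_le i : coef i <= M * q i.
  have := mulr_ge0 (addr_ge0 rC_ge0 D_ge0) (q2_ge0 i).
  by have := q1_ge0 i; rewrite /coef /M /q; lra.
have A_ge0 : 0 <= A by rewrite sumr_ge0// => i _; rewrite mulr_ge0// pred_error_ge0.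
have B_ge0 : 0 <= B by rewrite sumr_ge0// => i _; rewrite mulr_ge0// sqr_ge0.
have AB : A ^+ 2 <= (C1 + C2) * B.
  apply: le_trans (Jensen_sqr _ _ q_ge0) _; rewrite ler_wpM2r// big_split/=.
  by rewrite lerD// sum_le_of_summable.
have A_le : \sum_(0 <= tau < k) coef tau * pred_error xih t tau <= M * A.
  rewrite mulr_sumr; apply: ler_sum => i _.
  by rewrite mulrA ler_wpM2r// pred_error_ge0.
have last_le : coef k * pred_error xih t k <= M * q k.
  have c0 : 0 <= coef k by rewrite addr_ge0// mulr_ge0// addr_ge0.
  by apply: le_trans (coef_le k); rewrite ler_piMr// (pred_error_le1 valid).
move=> e_le.
have {}e_le : e t <= M * (A + (1 + 2 * r) * q k).
  have : 2 * r * coef k <= 2 * r * (M * q k) by rewrite ler_wpM2l// mulr_ge0 ?ltW.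
  by lra.
have rq_ge0 : 0 <= (1 + 2 * r) * q k by rewrite mulr_ge0// addr_ge0// mulr_ge0// ltW.
have e2 : e t ^+ 2 <= M ^+ 2 * (A + (1 + 2 * r) * q k) ^+ 2.
  rewrite -exprMn ler_sqr ?nnegrE ?enorm_ge0// mulr_ge0// addr_ge0//.
apply: le_trans e2 _.
rewrite (_ : policy_const * _ = M ^+ 2 * (2 * (C1 + C2 + 2 * (1 + 2 * r) ^+ 2)
   * (B + (q1 k ^+ 2 + q2 k ^+ 2)))); last by rewrite /policy_gain /M; ring.
rewrite ler_wpM2l ?sqr_ge0//.
have C12 : 0 <= C1 + C2.
  by case: q1S => _ ? _; case: q2S => _ ? _; rewrite addr_ge0// (le_trans ler01).
have Q_ge0 : 0 <= q1 k ^+ 2 + q2 k ^+ 2 by rewrite addr_ge0 ?sqr_ge0.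
have qk2 : q k ^+ 2 <= 2 * (q1 k ^+ 2 + q2 k ^+ 2).
  by have := sqr_ge0 (q1 k - q2 k); rewrite /q; lra.
have h1 := sqr_ge0 (A - (1 + 2 * r) * q k).
have h2 : (1 + 2 * r) ^+ 2 * q k ^+ 2 <=
    (1 + 2 * r) ^+ 2 * (2 * (q1 k ^+ 2 + q2 k ^+ 2)).
  by rewrite ler_wpM2l// sqr_ge0.
have h3 := mulr_ge0 C12 Q_ge0.
have h4 := mulr_ge0 (sqr_ge0 (1 + 2 * r)) B_ge0.
rewrite -exprMn in h2.
by lra.
Qed.

Local Notation E := (regret_error k xih q1 q2).

Lemma sum_sqr_policy_error : \sum_(0 <= t < T) e t ^+ 2 <= policy_const * E.
Proof.
apply: (@le_trans _ _ (policy_const * \sum_(0 <= t < T)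
   (\sum_(0 <= tau < k) (q1 tau + q2 tau) * pred_error xih t tau ^+ 2
     + (q1 k ^+ 2 + q2 k ^+ 2)))).
  by rewrite mulr_sumr; apply: ler_sum_nat => t /andP[_]; exact: sqr_policy_error.
by rewrite ler_wpM2l ?sum_power_error// policy_gain_ge0.
Qed.

Let dx t := enorm (x t - xs t).
(* No action is applied at the final time. *)
Let du t := if (t < T)%N then enorm (u t - us t) else 0.

Lemma sum_sqr_dx :
  \sum_(0 <= t < T.+1) dx t ^+ 2 <= (C3 * Lg) ^+ 2 * \sum_(0 <= t < T) e t ^+ 2.
Proof.
have := Young_causal_conv (fun s => Lg * e s) T q3S.
under [X in _ <= _ * X]eq_bigr do rewrite exprMn.
rewrite -mulr_sumr mulrA -exprMn; apply: le_trans.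
apply: ler_sum_nat => t /andP[_ tT].
rewrite ler_sqr ?nnegrE ?enorm_ge0 ?sumr_ge0//.
  by apply: tracking => // s st; exact/stays_near/ltnW/(leq_trans st).
by move=> s _; rewrite !mulr_ge0 ?enorm_ge0// ltW.
Qed.

(** The action deviation splits into the policy error and the deviation of the
clairvoyant action from the optimal one, which [q3 0 <= C3] ties to the state
deviation. *)
Lemma sqr_du t : (t < T)%N -> du t ^+ 2 <= 2 * e t ^+ 2 + 2 * C3 ^+ 2 * dx t ^+ 2.
Proof.
move=> tT; rewrite /du tT.
have dev : enorm (V t t - us t) <= C3 * dx t.
  apply: le_trans (perturb_action tT (near_ball (stays_near (ltnW tT)))
    (xs_ball t) (opt_s tT) (true_optP (ltnW tT))) _.
  by rewrite ler_wpM2r ?enorm_ge0//; exact: le_of_summable.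
have tri : enorm (u t - us t) <= e t + C3 * dx t.
  by apply: le_trans (enorm_triangle (V t t) _ _) _; rewrite lerD2l.
have : enorm (u t - us t) ^+ 2 <= (e t + C3 * dx t) ^+ 2.
  by rewrite ler_sqr ?nnegrE ?enorm_ge0// (le_trans _ tri) ?enorm_ge0.
by have := sqr_ge0 (e t - C3 * dx t); lra.
Qed.

Local Notation deviation_const := (deviation_gain Lg D r C1 C2 C3).

Lemma sum_sqr_deviation :
  \sum_(0 <= t < T.+1) Num.sqrt (dx t ^+ 2 + du t ^+ 2) ^+ 2 <= deviation_const * E.
Proof.
under eq_bigr do rewrite sqr_sqrtr ?addr_ge0 ?sqr_ge0//.
rewrite big_split/=.
have du_le : \sum_(0 <= t < T.+1) du t ^+ 2 <=
   2 * \sum_(0 <= t < T) e t ^+ 2 + 2 * C3 ^+ 2 * \sum_(0 <= t < T.+1) dx t ^+ 2.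
  rewrite big_nat_recr//= {2}/du ltnn expr0n addr0.
  apply: (@le_trans _ _ (\sum_(0 <= t < T) (2 * e t ^+ 2 + 2 * C3 ^+ 2 * dx t ^+ 2))).
    by apply: ler_sum_nat => t /andP[_]; exact: sqr_du.
  rewrite big_split/= -!mulr_sumr lerD2l ler_wpM2l//.
    by rewrite mulr_ge0// sqr_ge0.
  by apply: nonneg_sum_le_nat => // i; rewrite sqr_ge0.
apply: le_trans (lerD (lexx _) du_le) _.
have := sum_sqr_dx; have := sum_sqr_policy_error.
set S := \sum_(0 <= t < T) _; set X := \sum_(0 <= t < T.+1) _ => SE XS.
apply: (@le_trans _ _ (((1 + 2 * C3 ^+ 2) * (C3 * Lg) ^+ 2 + 2) * S)).
  have : (1 + 2 * C3 ^+ 2) * X <= (1 + 2 * C3 ^+ 2) * ((C3 * Lg) ^+ 2 * S).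
    by rewrite ler_wpM2l// addr_ge0// mulr_ge0// sqr_ge0.
  by lra.
rewrite /deviation_gain -mulrA ler_wpM2l//.
by rewrite addr_ge0// mulr_ge0 ?sqr_ge0// addr_ge0// mulr_ge0 ?sqr_ge0.
Qed.

Let cost_at (x' : nat -> state P) (u' : nat -> action P) t : R :=
  if (t < T)%N then stage_cost P t (x' t) (u' t) (true_param P t)
  else final_cost P (x' T) (true_param P T).

Let total_costE x' u' : total_cost x' u' = \sum_(0 <= t < T.+1) cost_at x' u' t.
Proof.
rewrite big_nat_recr//= {2}/cost_at ltnn; congr (_ + _).
by apply: eq_big_nat => t /andP[_ tT]; rewrite /cost_at tT.
Qed.

Hypothesis l_ge0 : 0 <= l.

Lemma cost_at_growth t : (t < T.+1)%N ->
  cost_at x u t - cost_at xs us t <=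
  2 * (Num.sqrt (l * cost_at xs us t) * Num.sqrt (dx t ^+ 2 + du t ^+ 2))
  + l * Num.sqrt (dx t ^+ 2 + du t ^+ 2) ^+ 2.
Proof.
have [_ _ stage_ok [fin_ge0 _ fin_smooth]] := standing.
rewrite ltnS leq_eqVlt => /orP[/eqP -> |tT]; last first.
  have [st_ge0 _ st_smooth] := stage_ok t tT.
  have := smooth_nonneg_growth l_ge0 st_smooth st_ge0
    (row_mx (xs t) (us t)) (row_mx (x t) (u t)).
  rewrite !row_mxKl !row_mxKr /cost_at tT.
  suff <- : enorm (row_mx (x t) (u t) - row_mx (xs t) (us t)) =
            Num.sqrt (dx t ^+ 2 + du t ^+ 2) by [].
  rewrite opp_row_mx add_row_mx -[LHS]ger0_norm ?enorm_ge0// -sqrtr_sqr.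
  by rewrite sqr_enorm_row_mx /du tT.
have := smooth_nonneg_growth l_ge0 fin_smooth fin_ge0 (xs T) (x T).
rewrite /cost_at /du ltnn expr0n addr0 sqrtr_sqr ger0_norm// enorm_ge0//.
Qed.

Lemma regret_bound :
  total_cost x u - total_cost xs us <=
  (2 * Num.sqrt (l * deviation_const) + l * `|deviation_const|)
   * (Num.sqrt (total_cost xs us * E) + E).
Proof.
have cs_ge0 t : (t < T.+1)%N -> 0 <= cost_at xs us t.
  have [_ _ stage_ok [fin_ge0 _ _]] := standing.
  move=> _; rewrite /cost_at; case: ltnP => // tT.
  have [/(_ (row_mx (xs t) (us t)))] := stage_ok t tT.
  by rewrite row_mxKl row_mxKr.
have := sum_sqrt_growth l_ge0 cs_ge0 cost_at_growth.
rewrite -!total_costE => /le_trans; apply.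
have := sum_sqr_deviation; set S := \sum_(0 <= t < T.+1) _ => SE.
have cost_ge0 : 0 <= total_cost xs us.
  rewrite total_costE big_nat_cond sumr_ge0// => t /andP[/andP[_ tT] _].
  exact: cs_ge0.
have E_ge0 : 0 <= E.
  apply: le_trans (sum_power_error k xih q1_ge0 q2_ge0).
  rewrite sumr_ge0// => t _.
  rewrite addr_ge0// ?sumr_ge0// ?addr_ge0 ?sqr_ge0// => tau _.
  by rewrite mulr_ge0 ?sqr_ge0// addr_ge0.
have dev_ge0 : 0 <= deviation_const.
  rewrite mulr_ge0 ?policy_gain_ge0// addr_ge0// mulr_ge0 ?sqr_ge0//.
  by rewrite addr_ge0// mulr_ge0 ?sqr_ge0.
rewrite (ger0_norm dev_ge0).
have main : Num.sqrt (l * total_cost xs us * S) <=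
  Num.sqrt (l * deviation_const) * Num.sqrt (total_cost xs us * E).
  rewrite -sqrtrM; last by rewrite mulr_ge0.
  by rewrite ler_wsqrtr// mulrACA ler_wpM2l// mulr_ge0.
have lS : l * S <= l * (deviation_const * E) by rewrite ler_wpM2l.
have h1 : 0 <= Num.sqrt (l * deviation_const) * E by rewrite mulr_ge0// sqrtr_ge0.
have h2 : 0 <= l * deviation_const * Num.sqrt (total_cost xs us * E).
  by apply: mulr_ge0; [exact: mulr_ge0|exact: sqrtr_ge0].
by lra.
Qed.

End MPC.

Theorem theorem3p3 (R : realType) (l Lg D r C1 C2 C3 : R)
    (l_ge0 : 0 <= l) (Lg_gt0 : 0 < Lg) :
  exists2 K : R, 0 <= K &
  forall (P : ocp R) (xs : nat -> state P) (us : nat -> action P)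
    (k : nat) (xih : predictions P) (q1 q2 q3 : nat -> R)
    (Fterm : forall tau, state P -> 'rV[R]_(pdim P tau) -> \bar R)
    (ybar : forall tau, 'rV[R]_(pdim P tau) -> state P)
    (x : nat -> state P) (u : nat -> action P),
  is_OPT xs us ->
  standing_assumptions l Lg D xs ->
  (1 <= k <= horizon P)%N ->
  valid_predictions k xih ->
  property_P k xs r q1 q2 q3 C1 C2 C3 ->
  (forall t, (t + k < horizon P)%N ->
     (forall y : state P,
        Fterm (t + k)%N y (xih t (t + k)%N)
        = indicator_cost y (ybar (t + k)%N (xih t (t + k)%N))) /\
     eball (xs (t + k)%N) r (ybar (t + k)%N (xih t (t + k)%N))) ->
  (forall t, (t < horizon P)%N ->
     \sum_(0 <= tau < k.+1)
        ((r / C3 + D) * q1 tau + q2 tau) * pred_error xih t tau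
     + 2%:R * r * ((r / C3 + D) * q1 k + q2 k)
     <= r / (C3 ^+ 2 * Lg)) ->
  is_mpc_trajectory k xih Fterm x u ->
  (forall t, (t <= horizon P)%N -> eball (xs t) (r / C3) (x t)) /\
  (let E := regret_error k xih q1 q2 in
   total_cost x u - total_cost xs us
     <= K * (Num.sqrt (total_cost xs us * E) + E)).
Proof.
pose H := deviation_gain Lg D r C1 C2 C3.
(* [H] is known to be nonnegative only once the perturbation property is assumed; the absolute value keeps the constant nonnegative in any case. *)
exists (2 * Num.sqrt (l * H) + l * `|H|).
  by rewrite addr_ge0 ?mulr_ge0 ?sqrtr_ge0 ?normr_ge0.
move=> P xs us k xih q1 q2 q3 Fterm ybar x u OPT std kT valid PP term small traj.
have [YV YV_opt] := exists_restarts x PP.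
split; last first.
  exact: (regret_bound Lg_gt0 OPT std kT valid PP term small traj YV_opt l_ge0).
exact: (stays_near Lg_gt0 OPT std kT valid PP term small traj YV_opt).
Qed.
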